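(* Let $c_n(t)$ denote the value at $q=-1$ of the $q$-Narayana polynomial $C_n(t;q)$. The generating function $$h(t,z)=\sum_{n\ge 0}c_{2n+1}(t)z^n$$ has the continued fraction expansion of Jacobi type $$h(t,z)=\cfrac{1}{1-s_0z-\cfrac{t_0z^2}{1-s_1z-\cfrac{t_1z^2}{1-\ddots}}}$$ with $s_0=1+t+t^2$, $s_n=1+t^2$ for all $n>0$, and $t_n=t^2$ for all $n\ge 0$.
   Context: Notation: $[n]=[n]_q=\sum_{j=0}^{n-1}q^j$, $[n]!=\prod_{j=1}^n[j]$, and $\begin{bmatrix}n\\k\end{bmatrix}=\frac{[n]!}{[k]!\,[n-k]!}$ for $0\le k\le n$ (and $0$ otherwise). For $n\ge 1$ the $q$-Narayana polynomials are $$C_n(t;q)=\sum_{k=0}^{n-1}q^{k^2+k}\begin{bmatrix}n\\k\end{bmatrix}\begin{bmatrix}n-1\\k\end{bmatrix}\frac{t^k}{[k+1]},$$ and $c_n(t)=\lim_{q\to-1}C_n(t;q)$ (coefficientwise in $t$). For example, $c_1(t)=1$, $c_2(t)=1+t$, $c_3(t)=1+t+t^2$, $c_4(t)=1+2t+2t^2+t^3$. Generating functions are formal power series in $z$ with coefficients in $\mathbb{Z}[t]$. The continued fraction is understood as a formal power series in $z$ (the $z$-adic limit of its finite truncations). Here $t$ is the polynomial variable, while $t_0,t_1,\dots$ (with indices) are the continued fraction coefficients. *)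

(* Defs.v *)
From HB Require Import structures.
From mathcomp Require Import all_boot all_order all_algebra.
From mathcomp Require Import all_classical all_reals all_analysis.
From mathcomp Require Import ring zify.
Set Implicit Arguments.
Unset Strict Implicit.
Unset Printing Implicit Defensive.
Import Order.TTheory GRing.Theory Num.Theory.
Import numFieldNormedType.Exports.
Local Open Scope classical_set_scope.
Local Open Scope ring_scope.

Section QNarayana.
Variable F : fieldType.

Definition qint (n : nat) (q : F) : F := \sum_(j < n) q ^+ j.

Definition qfact (n : nat) (q : F) : F := \prod_(1 <= j < n.+1) qint j q.

Definition qbinom (n k : nat) (q : F) : F :=
  if (k <= n)%N then qfact n q / (qfact k q * qfact (n - k) q) else 0.

(* A polynomial in t. At q = -1 some denominators vanish, so that the value of
   the right-hand side there is meaningless; only the limit matters below. *)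
Definition qNarayana (n : nat) (q : F) : {poly F} :=
  \poly_(k < n)
    (q ^+ (k ^ 2 + k) * qbinom n k q * qbinom n.-1 k q / qint k.+1 q).

End QNarayana.

(* The limit is taken over punctured neighbourhoods of -1; it exists by
   cvg_qNarayana. *)
Definition qNarayanaN1 (R : realType) (n : nat) : {poly R} :=
  \poly_(k < n) lim ((qNarayana n q)`_k @[q --> (-1 : R)^']).

Section PowerSeries.
Variable A : comUnitRingType.

(* f : nat -> A stands for the formal power series \sum_n (f n) z^n. *)
Definition fps := nat -> A.

Definition fps_monom (a : A) (k : nat) : fps := fun n => if n == k then a else 0.

Definition fps_mul (f g : fps) : fps :=
  fun n => \sum_(i < n.+1) f i * g (n - i)%N.

Definition fps_sub (f g : fps) : fps := fun n => f n - g n.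

(* The first n coefficients of 1/f, for f with invertible constant term. *)
Fixpoint fps_inv_seq (f : fps) (n : nat) : seq A :=
  if n is m.+1 then
    let s := fps_inv_seq f m in
    rcons s ((f 0%N)^-1 * ((m == 0%N)%:R - \sum_(i < m) f (m - i)%N * s`_i))
  else [::].

Definition fps_inv (f : fps) : fps := fun n => (fps_inv_seq f n.+1)`_n.

Lemma size_fps_inv_seq (f : fps) n : size (fps_inv_seq f n) = n.
Proof. by elim: n => //= n IH; rewrite size_rcons IH. Qed.

Lemma nth_fps_inv_seq (f : fps) n i :
  (i < n)%N -> (fps_inv_seq f n)`_i = fps_inv f i.
Proof.
elim: n => // n IH; rewrite ltnS leq_eqVlt => /orP[/eqP->//|lt_in].
by rewrite /= nth_rcons size_fps_inv_seq lt_in IH.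
Qed.

Lemma fps_mulV (f : fps) :
  f 0%N \is a GRing.unit -> fps_mul f (fps_inv f) = fps_monom 1 0.
Proof.
move=> f0; apply/funext => n; rewrite /fps_mul /fps_monom big_ord_recl /= subn0.
rewrite {1}/fps_inv /= nth_rcons size_fps_inv_seq ltnn eqxx mulVKr //.
rewrite (reindex_inj rev_ord_inj) /=.
under eq_bigr => i _.
  rewrite (nth_fps_inv_seq f (_ : n - i.+1 < n)%N); last by case: i => /=; lia.
  have -> : (n - (n - i.+1) = bump 0 i)%N by rewrite /bump /=; case: i => /=; lia.
  over.
by rewrite subrK; case: eqP.
Qed.

(* N-th truncation of 1/(1 - s_0 z - t_0 z^2/(1 - s_1 z - t_1 z^2/...)),
   with 1/(1 - s_N z) as its innermost fraction. *)
Fixpoint jfrac_trunc (s t : nat -> A) (N : nat) : fps :=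
  let d := fps_sub (fps_monom 1 0) (fps_monom (s 0%N) 1) in
  fps_inv
    (if N is M.+1 then
       fps_sub d (fps_mul (fps_monom (t 0%N) 2)
         (jfrac_trunc (fun n => s n.+1) (fun n => t n.+1) M))
     else d).

Definition zadic_cvg (u : nat -> fps) (f : fps) : Prop :=
  forall d : nat, \forall N \near \oo, forall i, (i < d)%N -> u N i = f i.

Definition is_jfrac (s t : nat -> A) (f : fps) : Prop :=
  zadic_cvg (jfrac_trunc s t) f.

End PowerSeries.

Section LimitExists.
Variable R : realType.
Implicit Types (q x : R) (n k : nat).

Let qi n : {poly R} := \sum_(j < n) 'X^j.

(* [n] with its factor 1 + q, present exactly when n is even, removed. *)
Let g n : {poly R} := if odd n then qi n else \sum_(j < n./2) 'X^(2 * j).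
Let G n : {poly R} := \prod_(1 <= j < n.+1) g j.

Let qiE n q : qint n q = (qi n).[q].
Proof.
by rewrite /qi horner_sum; apply: eq_bigr => i _; rewrite hornerXn.
Qed.

Let qintE n q : qint n q = (1 + q) ^+ (~~ odd n) * (g n).[q].
Proof.
rewrite /g; case: ifP => on; rewrite /= ?expr0 ?mul1r ?qiE // expr1 -qiE.
rewrite -[in LHS](even_halfK (negbT on)).
elim: n./2 => [|m IH]; first by rewrite /qint !big_ord0 horner0 mulr0.
rewrite doubleS /qint !big_ord_recr /= -/(qint _ q) IH hornerD hornerXn mul2n.
by rewrite exprS; ring.
Qed.

Let qfactE n q : qfact n q = (1 + q) ^+ n./2 * (G n).[q].
Proof.
elim: n => [|n IH].
  by rewrite /qfact /G !big_geq //= expr0 mul1r hornerC.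
have -> : qfact n.+1 q = qfact n q * qint n.+1 q by rewrite /qfact big_nat_recr.
have -> : G n.+1 = G n * g n.+1 by rewrite /G big_nat_recr.
rewrite IH qintE /= uphalf_half exprD negbK hornerM; ring.
Qed.

Let gN1 n : (0 < n)%N -> (g n).[-1] != 0.
Proof.
rewrite /g; case: ifP => on n0.
  rewrite -qiE -(odd_double_half n) on add1n.
  suff -> : qint n./2.*2.+1 (-1 : R) = 1 by exact: oner_neq0.
  elim: n./2 => [|m IH]; first by rewrite /qint big_ord1.
  by rewrite doubleS /qint 2!big_ord_recr /= -/(qint _ _) IH !exprS; ring.
rewrite horner_sum; under eq_bigr => i _.
  rewrite hornerXn exprM sqrrN expr1n expr1n; over.
by rewrite sumr_const card_ord pnatr_eq0; case: n on n0 => [|[|n]].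
Qed.

Let GN1 n : (G n).[-1] != 0.
Proof.
rewrite /G; elim: n => [|n IH]; first by rewrite big_geq // hornerC oner_neq0.
by rewrite big_nat_recr //= hornerM mulf_neq0 // gN1.
Qed.

Let cancel_pow x (a a' b c d e : nat) (A A' B C D E : R) : x != 0 ->
  (a + a' = b + c + (b + d) + e)%N ->
  (x ^+ a * A / (x ^+ b * B * (x ^+ c * C))) *
  (x ^+ a' * A' / (x ^+ b * B * (x ^+ d * D))) / (x ^+ e * E) =
  A * A' / (B * C * (B * D) * E).
Proof.
move=> x0 eq_exp.
have : x ^+ (a + a') / x ^+ (b + c + (b + d) + e) = 1.
  by rewrite eq_exp divff // expf_neq0.
rewrite !exprD !invfM => h; rewrite -[RHS]mul1r -h; ring.
Qed.

Lemma cvg_qNarayana n k : cvg ((qNarayana n q)`_k @[q --> (-1 : R)^']).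
Proof.
have [nk|kn] := leqP n k.
  under eq_fun do rewrite coef_poly ltnNge nk /=.
  exact: is_cvg_cst.
pose N : {poly R} := 'X^(k ^ 2 + k) * (G n * G n.-1).
pose D : {poly R} := G k * G (n - k) * (G k * G (n.-1 - k)) * g k.+1.
have DN1 : D.[-1] != 0 by rewrite !hornerM !mulf_neq0 // gN1.
apply/cvg_ex; exists (N.[-1] / D.[-1]).
apply: (@cvg_trans _ ((fun q : R => N.[q] / D.[q]) @ (-1 : R)^')); last first.
  apply: cvg_within_filter; apply: cvgM; first exact: continuous_horner.
  by apply: cvgV => //; exact: continuous_horner.
apply: near_eq_cvg; near=> q.
have q1 : 1 + q != 0.
  rewrite addrC addr_eq0; near: q; exact: nbhs_dnbhs_neq.
rewrite coef_poly kn /qbinom (ltnW kn) (_ : (k <= n.-1)%N); last by lia.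
rewrite /N /D !hornerM hornerXn !qfactE qintE /= negbK.
rewrite -[LHS]mulrA -(@cancel_pow (1 + q) n./2 n.-1./2 k./2 (n - k)./2
  (n.-1 - k)./2 (odd k)) ?mulrA //; lia.
Unshelve. all: by end_near. Qed.
End LimitExists.

(* Main.v *)
(* Since [n-1 choose k] / [k+1] = [n choose k+1] / [n], the coefficients of
   C_(2m+1) have no singularity at q = -1, and the values of Gaussian binomials
   there give
     c_(2m+1)(t) = sum_k C(m, floor(k/2)) C(m, floor((k+1)/2)) t^k,
   which is the constant coefficient of (1 + u) ((1 + t u) (1 + t / u))^m in u.
   The coefficients of the powers of (1 + t u) (1 + t / u) = 1 + t^2 + t (u + 1/u)
   count weighted walks on the integers; adding those of u^k and u^(k+1)
   amounts to folding the line by i <-> -1 - i, which turns them into walks on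
   the nonnegative integers whose level weight at 0 is 1 + t + t^2. The
   three-term recurrence of these sums yields the continued fraction. *)
Require Import Defs.
From mathcomp Require Import all_boot all_order all_algebra.
From mathcomp Require Import all_classical all_reals all_analysis.
From mathcomp Require Import ring zify.
Set Implicit Arguments.
Unset Strict Implicit.
Import Order.TTheory GRing.Theory Num.Theory.
Local Open Scope ring_scope.

(** * Power series products and truncated continued fractions *)

Section PowerSeriesAlgebra.
Variable A : comUnitRingType.
Implicit Types f g h : fps A.

(** Reduces ring laws for series to those of truncated polynomials. *)
Lemma coef_fps_mul f g d i : (i < d)%N ->
  fps_mul f g i = ((\poly_(j < d) f j) * (\poly_(j < d) g j))`_i.
Proof.
move=> id; rewrite coefM; apply: eq_bigr => j _; rewrite !coef_poly.
by rewrite !ifT //; have := ltn_ord j; lia.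
Qed.

Lemma fps_mulC f g : fps_mul f g = fps_mul g f.
Proof. by apply/funext => n; rewrite !(@coef_fps_mul _ _ n.+1) // mulrC. Qed.

Lemma fps_mulA f g h :
  fps_mul f (fps_mul g h) = fps_mul (fps_mul f g) h.
Proof.
have mul3 (a b c : fps A) n : fps_mul a (fps_mul b c) n =
    ((\poly_(j < n.+1) a j) *
     ((\poly_(j < n.+1) b j) * (\poly_(j < n.+1) c j)))`_n.
  rewrite coefM; apply: eq_bigr => j _.
  by rewrite coef_poly ltn_ord (@coef_fps_mul _ _ n.+1) // ltnS leq_subr.
apply/funext => n; rewrite mul3 mulrA mulrC.
by rewrite [in RHS]fps_mulC mul3.
Qed.

Lemma fps_mul1 f : fps_mul (fps_monom 1 0) f = f.
Proof.
apply/funext => n; rewrite /fps_mul big_ord_recl /fps_monom /= mul1r subn0.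
by rewrite big1 ?addr0 // => i _; rewrite mul0r.
Qed.

Lemma fps_monom_mul a k f n :
  fps_mul (fps_monom a k) f n = if (k <= n)%N then a * f (n - k)%N else 0.
Proof.
rewrite /fps_mul /fps_monom; case: leqP => kn.
  rewrite (bigD1 (Ordinal (kn : (k < n.+1)%N))) //= eqxx big1 ?addr0 //.
  move=> i; rewrite -val_eqE /= => /negbTE ->; exact: mul0r.
rewrite big1 // => i _; rewrite ifF ?mul0r //.
by apply/negbTE; have := ltn_ord i; lia.
Qed.

Lemma fps_mulBl f g h :
  fps_mul (fps_sub f g) h = fps_sub (fps_mul f h) (fps_mul g h).
Proof.
apply/funext => n; rewrite /fps_sub /fps_mul -sumrB.
by apply: eq_bigr => i _; rewrite mulrBl.
Qed.

Lemma eq_fps_mul f g h d : (forall i, (i < d)%N -> g i = h i) ->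
  forall i, (i < d)%N -> fps_mul f g i = fps_mul f h i.
Proof.
move=> gh i id; apply: eq_bigr => j _; congr (_ * _); apply: gh.
by rewrite (leq_ltn_trans (leq_subr _ _)).
Qed.

Lemma fps_inv_mul_eq f g h d : f 0%N \is a GRing.unit ->
    (forall i, (i < d)%N -> fps_mul f g i = h i) ->
  forall i, (i < d)%N -> fps_mul (fps_inv f) h i = g i.
Proof.
move=> f0 fg i id.
rewrite -(@eq_fps_mul _ (fps_mul f g) _ d) // fps_mulA.
by rewrite (fps_mulC (fps_inv f)) fps_mulV // fps_mul1.
Qed.

(* Writing K_n for [K n.+1], dividing the recurrence by K_n shows that the
   quotients f_n = K_n / K_(n-1) satisfy
   f_n = 1 / (1 - s_n z - t_n z^2 f_(n+1)). *)
Lemma jfrac_trunc_mul (s t : nat -> A) (K : nat -> fps A) N :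
    (forall n m, K n.+1 m =
       K n m + (if (1 <= m)%N then s n * K n.+1 (m - 1)%N else 0)
             + (if (2 <= m)%N then t n * K n.+2 (m - 2)%N else 0)) ->
  forall i, (i < 2 * N + 2)%N -> fps_mul (jfrac_trunc s t N) (K 0%N) i = K 1%N i.
Proof.
elim: N s t K => [|N IH] s t K HK /=; apply: fps_inv_mul_eq.
- by rewrite /fps_sub /fps_monom /= subr0 unitr1.
- move=> i i2; rewrite fps_mulBl /fps_sub fps_mul1 fps_monom_mul HK.
  (* The innermost fraction lacks a $z^2$ term, which is invisible in degrees below 2. *)
  by rewrite (_ : (2 <= i)%N = false) ?addr0 ?addrK //; lia.
- rewrite /fps_sub fps_monom_mul /fps_monom /= !subr0; exact: unitr1.
move=> i iN; rewrite !fps_mulBl -fps_mulA /fps_sub fps_mul1 !fps_monom_mul HK.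
case: (leqP 2 i) => i2; last by rewrite subr0 addr0 addrK.
(* The factor $z^2$ lowers the degree by 2, so each level gains two exact coefficients. *)
rewrite (IH _ _ (fun n => K n.+1)); [by ring | by move=> n m; exact: HK | lia].
Qed.

Lemma is_jfrac_quotient (s t : nat -> A) (K : nat -> fps A) :
    K 0%N = fps_monom 1 0 ->
    (forall n m, K n.+1 m =
       K n m + (if (1 <= m)%N then s n * K n.+1 (m - 1)%N else 0)
             + (if (2 <= m)%N then t n * K n.+2 (m - 2)%N else 0)) ->
  is_jfrac s t (K 1%N).
Proof.
move=> K0 HK d; exists d => // N /= dN i id.
rewrite -(jfrac_trunc_mul (N := N) HK); last by lia.
by rewrite K0 fps_mulC fps_mul1.
Qed.

End PowerSeriesAlgebra.

(** * Recurrences for sums of products of two binomials *)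

Section BinomialSums.
Variable R : comNzRingType.
Implicit Types (x : R) (m k n : nat).

(* The coefficient of u^k in ((1 + x u) (1 + x / u))^m, divided by x^k. *)
Definition binsum x m k : R := \sum_(j < m.+1) ('C(m, j) * 'C(m, j + k))%:R * x ^+ (2 * j).

Lemma binsum_widen x m k n : (m < n)%N ->
  binsum x m k = \sum_(j < n) ('C(m, j) * 'C(m, j + k))%:R * x ^+ (2 * j).
Proof.
move=> mn; rewrite /binsum.
rewrite (big_ord_widen n (fun j => ('C(m, j) * 'C(m, j + k))%:R * x ^+ (2 * j))) //.
rewrite big_mkcond; apply: eq_bigr => j _; case: ltnP => // mj.
by rewrite bin_small ?mul0n ?mul0r.
Qed.

Lemma binsum_small x m k : (m < k)%N -> binsum x m k = 0.
Proof.
by move=> mk; apply: big1 => j _; rewrite (bin_small (m := j + k)) ?muln0 ?mul0r //; lia.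
Qed.

Lemma binsum_diag x m : binsum x m m = 1.
Proof.
rewrite /binsum big_ord_recl /= bin0 add0n binn muln1 expr0 mulr1.
by rewrite big1 ?addr0 // => j _; rewrite (bin_small (m := _ + m)) ?muln0 ?mul0r //= /bump; lia.
Qed.

(** The [if] encodes $C(m, j-1)$, zero at $j = 0$, as it arises from Pascal's rule. *)
Lemma binsum_shift x m k :
  \sum_(j < m.+2) ((if nat_of_ord j is i.+1 then 'C(m, i) else 0) * 'C(m, j + k))%:R * x ^+ (2 * j)
  = x ^+ 2 * binsum x m k.+1.
Proof.
rewrite big_ord_recl /= mul0n mul0r add0r /binsum mulr_sumr.
apply: eq_bigr => j _; rewrite /bump /= add1n addnS addSn mulnS exprD; ring.
Qed.

Lemma binsum_recS x m k : binsum x m.+1 k.+1 =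
  binsum x m k + (1 + x ^+ 2) * binsum x m k.+1 + x ^+ 2 * binsum x m k.+2.
Proof.
rewrite mulrDl mul1r -!binsum_shift.
rewrite (@binsum_widen x m k m.+2) // (@binsum_widen x m k.+1 m.+2) // /binsum.
rewrite -!big_split /=; apply: eq_bigr => -[[|j] jm] _ /=.
  rewrite !add0n !bin0 binS; ring.
rewrite !addnS !binS; ring.
Qed.

(** The two neighbours $u$ and $1/u$ of the constant term contribute equally, hence the factor 2. *)
Lemma binsum_rec0 x m : binsum x m.+1 0 =
  (1 + x ^+ 2) * binsum x m 0 + x ^+ 2 * binsum x m 1 *+ 2.
Proof.
have e0 : x ^+ 2 * binsum x m 0 = \sum_(j < m.+2)
    ((if nat_of_ord j is i.+1 then 'C(m, i) else 0) ^ 2)%:R * x ^+ (2 * j).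
  rewrite big_ord_recl /= mul0r add0r /binsum mulr_sumr.
  apply: eq_bigr => j _; rewrite /bump /= add1n addn0 mulnS exprD mulnn; ring.
rewrite mulrDl mul1r e0 -binsum_shift.
rewrite (@binsum_widen x m 0 m.+2) // /binsum -sumrMnl.
rewrite -!big_split /=; apply: eq_bigr => -[[|j] jm] _ /=.
  rewrite !bin0; ring.
rewrite !addn0 !binS; ring.
Qed.

End BinomialSums.

(** * Gaussian binomials and their values at $q = -1$ *)

Section GaussianBinomials.
Variable F : fieldType.
Implicit Types (q : F) (n k : nat).

(** Gaussian binomials by the $q$-Pascal rule: without division, evaluation at $-1$ makes sense. *)
Fixpoint gauss n k : {poly F} :=
  match n, k with
  | _, 0 => 1
  | 0, _.+1 => 0
  | n'.+1, k'.+1 => gauss n' k' + 'X^k * gauss n' k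
  end.

Lemma gauss_n0 n : gauss n 0 = 1.
Proof. by case: n. Qed.

Lemma gaussSS n k : gauss n.+1 k.+1 = gauss n k + 'X^(k.+1) * gauss n k.+1.
Proof. by []. Qed.

Lemma qfactS n q : qfact n.+1 q = qfact n q * qint n.+1 q.
Proof. by rewrite /qfact big_nat_recr. Qed.

Lemma qfact0 q : qfact 0 q = 1.
Proof. by rewrite /qfact big_geq. Qed.

Lemma qintD m n q : qint (m + n) q = qint m q + q ^+ m * qint n q.
Proof.
rewrite /qint big_split_ord /= mulr_sumr; congr (_ + _).
by apply: eq_bigr => i _; rewrite exprD.
Qed.

Section Generic.
Variable q : F.
Hypothesis qint_neq0 : forall n, qint n.+1 q != 0.

Lemma qfact_neq0 n : qfact n q != 0.
Proof. by elim: n => [|n IH]; rewrite ?qfact0 ?oner_neq0 // qfactS mulf_neq0. Qed.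

Lemma qbinom_gauss n k : qbinom n k q = (gauss n k).[q].
Proof.
elim: n k => [|n IH] [|k]; rewrite /= ?hornerE.
- by rewrite /qbinom /= qfact0 mulr1 divr1.
- by [].
- by rewrite /qbinom /= subn0 qfact0 mul1r divff ?qfact_neq0.
rewrite ?hornerXn -!IH /qbinom ltnS subSS; case: (ltngtP k n) => [kn|kn|->].
- have -> : (n - k = (n - k.+1).+1)%N by lia.
  (* This splits $[n+1]$ as $[k+1] + q^{k+1}[n-k]$, one summand for each term of the $q$-Pascal
     rule. *)
  have nE : (n.+1 = k.+1 + (n - k.+1).+1)%N by lia.
  rewrite qfactS {1}nE qintD !qfactS.
  field; rewrite !qint_neq0 !qfact_neq0 //.
- by rewrite mulr0 addr0.
by rewrite subnn qfact0 !mulr1 !divff ?qfact_neq0 // mulr0 addr0.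
Qed.

Lemma qbinom_div_qint n k : (k <= n)%N ->
  qbinom n k q / qint k.+1 q = qbinom n.+1 k.+1 q / qint n.+1 q.
Proof.
move=> kn; rewrite /qbinom ltnS kn subSS !qfactS.
by field; rewrite !qint_neq0 !qfact_neq0.
Qed.

End Generic.

(** The case $q = -1$ of the $q$-Lucas theorem. Each even row yields the odd row after it, where
    only one of the two terms survives. *)
Lemma gaussN1 m k :
  (gauss m.*2.+1 k).[-1] = ('C(m, k./2))%:R /\
  (gauss m.*2 k).[-1] = (if odd k then 0 else 'C(m, k./2))%:R.
Proof.
have odd_row n : (forall k, (gauss n.*2 k).[-1] = (if odd k then 0 else 'C(n, k./2))%:R) ->
    forall k, (gauss n.*2.+1 k).[-1] = ('C(n, k./2))%:R.
  move=> IH [|j]; rewrite /= ?hornerE ?bin0 // ?hornerXn !IH /= uphalf_half.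
  by rewrite -signr_odd /=; case: (odd j); rewrite /= ?expr0 ?expr1; ring.
suff even_row : forall k, (gauss m.*2 k).[-1] = (if odd k then 0 else 'C(m, k./2))%:R.
  by split; [exact: odd_row|].
elim: m {k} => [|m IH] [|k]; try by rewrite gauss_n0 bin0 -polyC1 hornerC.
  by rewrite /= horner0 uphalf_half; case: (odd k).
(* At an odd index [k.+1] two equal terms cancel; at an even one Pascal's rule applies. *)
rewrite doubleS gaussSS hornerD hornerM hornerXn !(odd_row _ IH) -signr_odd /= uphalf_half.
by case: (odd k); rewrite /= ?add0n ?add1n ?expr0 ?expr1 ?binS; ring.
Qed.

Lemma qint_oddN1 m : qint m.*2.+1 (-1 : F) = 1.
Proof.
elim: m => [|m IH]; first by rewrite /qint big_ord1.
by rewrite doubleS /qint 2!big_ord_recr /= -/(qint _ _) IH !exprS; ring.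
Qed.

End GaussianBinomials.

(** * The limit at $q = -1$ for odd index *)

Section LimitAtMinusOne.
Local Open Scope classical_set_scope.
Import numFieldNormedType.Exports.
Variable R : realType.
Implicit Types (q : R) (m n k : nat).

(** A zero of $[n+1]$ would be a real root of unity, and $-1$ is the only negative one. *)
Lemma qint_neq0_near q : q < 0 -> q != -1 -> forall n, qint n.+1 q != 0.
Proof.
move=> q0 q1 n; apply: contraNneq q1 => qn.
have /eqP : q ^+ n.+1 - 1 = 0 by rewrite subrX1 -/(qint n.+1 q) qn mulr0.
rewrite subr_eq0 => /eqP /(congr1 Num.norm); rewrite normrX normr1 => /eqP.
by rewrite pexpr_eq1 // (ltr0_norm q0) eqr_oppLR.
Qed.

Lemma lim_qNarayana_odd m k : (k <= m.*2)%N ->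
  lim ((qNarayana m.*2.+1 q)`_k @[q --> (-1 : R)^']) =
  ('C(m, k./2) * 'C(m, uphalf k))%:R.
Proof.
move=> km; set n := m.*2.+1.
(* Near $-1$ the coefficient equals [N / D], which is continuous there since $[n] = 1$ at $-1$ for
   odd $n$. *)
pose N : {poly R} := 'X^(k ^ 2 + k) * (gauss R n k * gauss R n k.+1).
pose D : {poly R} := \sum_(j < n) 'X^j.
have DE q : D.[q] = qint n q.
  by rewrite horner_sum; apply: eq_bigr => j _; rewrite hornerXn.
have -> : ('C(m, k./2) * 'C(m, uphalf k))%:R = N.[-1] / D.[-1].
  rewrite DE qint_oddN1 divr1 !hornerM hornerXn !(gaussN1 _ _ _).1 natrM.
  (* The exponent $k^2 + k$ is even, so the sign is 1. *)
  by rewrite -signr_odd oddD oddX /= addbb mul1r.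
apply/cvg_lim => //.
apply: (@cvg_trans _ ((fun q : R => N.[q] / D.[q]) @ (-1 : R)^')); last first.
  apply: cvg_within_filter; apply: cvgM; first exact: continuous_horner.
  by apply: cvgV; [rewrite DE qint_oddN1 oner_neq0 | exact: continuous_horner].
apply: near_eq_cvg; near=> q.
have q1 : q != -1 by near: q; exact: nbhs_dnbhs_neq.
have q0 : q < 0.
  near: q; apply: nbhs_dnbhs; apply: lt_nbhsl; exact: ltrN10.
have qn := qint_neq0_near q0 q1.
rewrite coef_poly ltnS km DE /N !hornerM hornerXn -!qbinom_gauss //.
by rewrite -[n.-1]/m.*2 -[RHS]mulrA (qbinom_div_qint qn km) !mulrA.
Unshelve. all: by end_near. Qed.

Lemma qNarayanaN1_odd m :
  qNarayanaN1 R m.*2.+1 = binsum 'X m 0 + 'X * binsum 'X m 1.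
Proof.
pose L k : {poly R} := ('C(m, k./2) * 'C(m, uphalf k))%:R * 'X^k.
have pairs n : \sum_(k < n.*2) L k = \sum_(j < n) (L (2 * j)%N + L (2 * j).+1).
  by elim: n => [|n IH]; rewrite ?big_ord0 // doubleS !big_ord_recr /= IH mul2n addrA.
(* The added index $k = 2m+1$ allows pairing; its term vanishes because $C(m, m+1) = 0$. *)
have -> : qNarayanaN1 R m.*2.+1 = \sum_(k < m.+1.*2) L k.
  rewrite doubleS big_ord_recr /= /L [X in _ + X](_ : _ = 0); last first.
    by rewrite /= doubleK (bin_small (m := m.+1)) ?muln0 ?mul0r.
  rewrite addr0 /qNarayanaN1 poly_def; apply: eq_bigr => -[k km] _ /=.
  by rewrite lim_qNarayana_odd // -mul_polyC polyC_natr.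
rewrite pairs big_split /= mulr_sumr; congr (_ + _); apply: eq_bigr => j _.
  by rewrite /L mul2n uphalf_double doubleK addn0.
by rewrite /L mul2n /= uphalf_double doubleK addn1 exprS; ring.
Qed.

End LimitAtMinusOne.

Theorem theorem4 (R : realType) (s t : nat -> {poly R})
    (hs0 : s 0%N = 1 + 'X + 'X^2)
    (hs : forall n : nat, (0 < n)%N -> s n = 1 + 'X^2)
    (ht : forall n : nat, t n = 'X^2) :
  is_jfrac s t (fun n : nat => qNarayanaN1 R (2 * n + 1)%N).
Proof.
pose S := binsum ('X : {poly R}).
(* Total weight of the folded walks of length $m + k$ from level 0 to level $k$, divided by
   $t^k$. *)
pose K n : fps {poly R} := if n is k.+1 then
  fun m => S (m + k)%N k + 'X * S (m + k)%N k.+1 else fps_monom 1 0.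
have -> : (fun n => qNarayanaN1 R (2 * n + 1)%N) = K 1%N.
  by apply/funext => m; rewrite mul2n addn1 qNarayanaN1_odd /= addn0.
apply: is_jfrac_quotient => // n m.
(* The formula also covers $m = 1$: a walk of length $n$ cannot reach level $n + 1$, so both sides
   are 0. *)
have tK : (if (2 <= m)%N then t n * K n.+2 (m - 2)%N else 0) =
    if m is p.+1 then 'X^2 * (S (p + n)%N n.+1 + 'X * S (p + n)%N n.+2) else 0.
  case: m => [|[|p]] //=.
    by rewrite add0n /S !binsum_small // mulr0 addr0 mulr0.
  by rewrite ht subSS subn1 /= addSnnS.
rewrite tK; case: m {tK} => [|p].
  rewrite !addr0 /= add0n /S binsum_diag binsum_small // mulr0 addr0.
  by case: n => [|n] //=; rewrite add0n /S binsum_diag binsum_small //; ring.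
rewrite subSS subn0 /= addSn; case: n => [|n].
  (* The extra ['X] in $s_0$ collects the term ['X * S p 0] and one of the two copies of
     ['X^2 * S p 1]. *)
  by rewrite hs0 addn0 /S binsum_rec0 binsum_recS /fps_monom /=; ring.
by rewrite hs // [K _ _]/= addSnnS /S !binsum_recS; ring.
Qed.
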